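(* Let $L$ be a lattice of rank $d$ and let $P\subset L\otimes_{\mathbb{Z}}\mathbb{R}$ be a rational polytope of full dimension $d$. Then $$\lim_{\epsilon\to 0}\ \frac{\epsilon^d}{d!}\,K_P(e^{\epsilon};\mathbf{z})=\mathrm{Vol}^\vee_{\mathbf{z}}(P).$$
   Context: Identify $L\cong\mathbb{Z}^d$ and $L^\vee=\mathrm{Hom}_{\mathbb{Z}}(L,\mathbb{Z})\cong\mathbb{Z}^d$ by dual bases; $\mathbf{z}\in L\otimes\mathbb{R}$, and $\mathbf{v}(\mathbf{x})$ denotes the pairing. A polytope is rational if its vertices lie in $L\otimes\mathbb{Q}$. The support function of $S$ is $h_S(\mathbf{v})=-\min_{\mathbf{x}\in S}\mathbf{v}(\mathbf{x})$, and $P-\mathbf{z}$ is the translate of $P$ by $-\mathbf{z}$. For a face $F$ of $P$, $C_F=\{\mathbf{v}\in L^\vee\otimes\mathbb{R}: \min_{\mathbf{x}\in P}\mathbf{v}(\mathbf{x})=\mathbf{v}(\mathbf{p})\ \forall\mathbf{p}\in F\}$; the normal fan $\mathcal{N}(P)$ is the collection of all $C_F$. The dual lattice function is $K_P(y_0;\mathbf{z})=\sum_{\mathbf{v}\in L^\vee}y_0^{-h_{P-\mathbf{z}}(\mathbf{v})}$. For real $y_0>1$ and $\mathbf{z}$ in the interior of $P$ the series converges, and its sum is a finite sum of quotients whose numerators and denominators are finite integer combinations of powers $y_0^{\mathbf{v}(\mathbf{p}-\mathbf{z})}$ with $\mathbf{v}\in L^\vee$ and $\mathbf{p}$ a vertex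 of $P$; $K_P$ denotes this closed-form function wherever it is defined, and $K_P(e^\epsilon;\mathbf{z})$ is its value at $y_0=e^\epsilon$. The dual volume function: let $\mathcal{T}=\{C_1,\ldots,C_N\}$ be any triangulation of $\mathcal{N}(P)$ into full-dimensional rational simplicial cones, each cone being generated by the primitive integral vectors $\mathbf{u}_{j_1},\ldots,\mathbf{u}_{j_d}\in L^\vee$ on its extremal rays. Then $$\mathrm{Vol}^\vee_{\mathbf{z}}(P)=\sum_{C=\mathrm{span}_{\mathbb{R}_{\ge 0}}(\mathbf{u}_{j_1},\ldots,\mathbf{u}_{j_d})\in\mathcal{T}}\frac{|\det(\mathbf{u}_{j_1},\ldots,\mathbf{u}_{j_d})|}{h_{P-\mathbf{z}}(\mathbf{u}_{j_1})\cdots h_{P-\mathbf{z}}(\mathbf{u}_{j_d})},$$ a rational function of $\mathbf{z}$.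
   Formalization: With Vol^∨ defined as the sum of |det|/∏h, the stated limit is off by a factor d! (for P=[-1,1]^2, z=0 the limit is 2 but Vol^∨ is 4); the formal theorem proves that the limit equals Vol^∨_z(P)/d!, for every z at which no h_{P-z}(u_j) vanishes. *)

(* Defs.v *)
From HB Require Import structures.
From mathcomp Require Import all_boot all_order all_algebra.
From mathcomp Require Import all_classical all_reals all_analysis.
Import Order.TTheory GRing.Theory Num.Theory numFieldNormedType.Exports.

Set Implicit Arguments.
Unset Strict Implicit.
Unset Printing Implicit Defensive.

Local Open Scope classical_set_scope.
Local Open Scope ring_scope.

(* The lattice L is Z^d: points of L (x) R are columns 'cV[R]_d, vectors of the
   dual space are rows 'rV[R]_d, and L^vee is 'rV[int]_d, embedded by [latt]. *)

Section Convexity.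
Variables (R : realType) (V : lmodType R).
Implicit Types A F S : set V.

Definition conv_hull A : set V :=
  [set x | exists n (w : 'I_n -> R) (a : 'I_n -> V),
     [/\ forall i, A (a i), forall i, 0 <= w i,
         \sum_i w i = 1 & x = \sum_i w i *: a i]].

Definition affine_hull A : set V :=
  [set x | exists n (w : 'I_n -> R) (a : 'I_n -> V),
     [/\ forall i, A (a i), \sum_i w i = 1 & x = \sum_i w i *: a i]].

Definition is_polytope S :=
  exists2 A : set V, finite_set A & S = conv_hull A.

(* Nonempty faces; S is a face of itself (take l = 0). Used both for polytopes
   and for cones. *)
Definition is_face F S :=
  F !=set0 /\
  exists l : {scalar V}, F = [set x | S x /\ forall y, S y -> l x <= l y].

Definition is_vertex (p : V) S := is_face [set p] S.

Definition translate S (z : V) : set V := [set x - z | x in S].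

End Convexity.

Section DualLattice.
Variables (R : realType) (d : nat).
Implicit Types (P F : set 'cV[R]_d) (z p : 'cV[R]_d).

Definition latt (v : 'rV[int]_d) : 'rV[R]_d := map_mx intr v.

Definition pairing (v : 'rV[R]_d) (x : 'cV[R]_d) : R := (v *m x) 0 0.

Definition rational_polytope P :=
  is_polytope P /\
  forall p, is_vertex p P -> forall i, exists q : rat, p i 0 = ratr q.

Definition full_dimensional P := affine_hull P = setT.

(* The infimum is a minimum when P is a (nonempty) polytope. *)
Definition min_on P (v : 'rV[R]_d) : R := inf [set pairing v x | x in P].

Definition supp_fun P (v : 'rV[R]_d) : R := - min_on P v.

Definition normal_cone P F : set 'rV[R]_d :=
  [set v | forall p, F p -> min_on P v = pairing v p].

Definition normal_fan P : set (set 'rV[R]_d) :=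
  [set normal_cone P F | F in [set F | is_face F P]].

(* A simplicial cone is given by the integer matrix of its generators (rows). *)
Definition cone (U : 'M[int]_d) : set 'rV[R]_d :=
  [set \sum_k c k *: latt (row k U) | c in [set c : 'I_d -> R | forall k, 0 <= c k]].

Definition primitive (u : 'rV[int]_d) := \big[gcdn/0%N]_j `|u 0%R j|%N = 1%N.

(* T lists, without repetition, the maximal cones of a simplicial fan which
   refines the normal fan of P and has the same support. *)
Definition is_triangulation P (N : nat) (T : 'I_N -> 'M[int]_d) :=
  [/\ forall i, \det (T i) != 0 /\ forall k, primitive (row k (T i)),
      injective (fun i => cone (T i)),
      forall i j, is_face (cone (T i) `&` cone (T j)) (cone (T i)),
      forall i, exists2 C, normal_fan P C & cone (T i) `<=` C
    & \bigcup_i cone (T i) = \bigcup_(C in normal_fan P) C].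

(* This sum is d! times the Euclidean volume of the polar dual of P - z when z
   is interior to P. *)
Definition dual_volume P (N : nat) (T : 'I_N -> 'M[int]_d) z : R :=
  \sum_i `|\det (T i)|%:~R
           / \prod_k supp_fun (translate P z) (latt (row k (T i))).

(* An element [(c, v, p)] of an exponential sum stands for c y^(v (p - z)). *)
Definition expsum := seq (int * 'rV[int]_d * 'cV[R]_d).

Definition eval_expsum (E : expsum) (y : R) z : R :=
  \sum_(t <- E) t.1.1%:~R * y `^ pairing (latt t.1.2) (t.2 - z).

(* Formal sums of quotients (numerator, denominator). *)
Definition quotsum := seq (expsum * expsum).

Definition eval_quotsum (Q : quotsum) (y : R) z : R :=
  \sum_(q <- Q) eval_expsum q.1 y z / eval_expsum q.2 y z.

Definition defined_at (Q : quotsum) (y : R) z :=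
  0 < y /\ forall q, q \in Q -> eval_expsum q.2 y z != 0.

Definition at_vertices P (E : expsum) := forall t, t \in E -> is_vertex t.2 P.

Definition dual_series P (y : R) z : \bar R :=
  (\esum_(v in [set: 'rV[int]_d])
     (y `^ (- supp_fun (translate P z) (latt v)))%:E)%R.

Definition is_closed_form P (Q : quotsum) :=
  (forall q, q \in Q -> at_vertices P q.1 /\ at_vertices P q.2) /\
  forall y z, 1 < y -> P° z ->
    defined_at Q y z /\ dual_series P y z = (eval_quotsum Q y z)%:E.

(* The common value at (y, z) of all closed forms of the series which are
   defined there (they agree, by linear independence of exponentials); 0 where
   no closed form is defined. *)
Definition dual_lattice_function P (y : R) z : R :=
  xget 0 [set k | exists Q, [/\ is_closed_form P Q, defined_at Q y z
                              & k = eval_quotsum Q y z]].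

End DualLattice.

(* Main.v *)
Require Import Defs.
From HB Require Import structures.
From mathcomp Require Import all_boot all_order all_algebra.
From mathcomp Require Import all_classical all_reals all_analysis.
From mathcomp Require Import ring lra.

(** The theorem is the passage from a lattice sum to a volume, made exact by the
    fan. On a cone [C] of the triangulation a single vertex [p] minimises every
    functional, so that the summand of the dual series at [v] in [C] is the
    exponential [y^(v (p - z))]. The triangulation is cut into half-open
    simplicial cones which partition the dual lattice: an infinitesimal push in
    a generic direction [x] decides to which cone a lattice point on a wall
    belongs. A lattice point of a half-open cone with generators [u_k] is, in a
    unique way, a point [w] of a half-open parallelepiped plus a combination of
    the [u_k] with coefficients in [nat]; summing geometric series,

      [K_P(y; z) = sum_C (sum_w y^(w (p - z))) / prod_k (1 - y^(u_k (p - z)))].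

    When [y = e^eps], each factor [eps / (1 - e^(eps u_k (p - z)))] tends to
    [1 / h(u_k)], where [h] is the support function of [P - z], and each
    numerator tends to the number of points [w], which is [|det|], the index of
    the sublattice spanned by the [u_k]. This gives the formula for
    [eps^d K_P(e^eps; z)].

    The value of [K_P] at [(y, z)] is, by definition, the value of any closed
    form of the series that is defined there, and [(y, z)] may be far from the
    region [1 < y], [z] interior, where the series converges. One therefore has
    to know that two closed forms agree wherever both are defined
    ([closed_form_unique]). After clearing denominators this is a vanishing
    statement for exponential sums in one real variable: such a sum vanishes
    identically once it vanishes near a point ([expsum_eq0_nbhs]). It is applied
    along the line joining [z] to an interior point, and then in the variable
    [ln y].

    The other main steps are [half_open_partition] (the half-open cones
    partition the dual space), [parallelepiped_points] (the count [|det|], from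
    the Smith normal form), [esum_half_open] (the sum over one half-open cone)
    and [cvg_geometric_pole] (the limit of one factor). *)

Import Order.TTheory GRing.Theory Num.Theory numFieldNormedType.Exports.

Set Implicit Arguments.
Unset Strict Implicit.
Unset Printing Implicit Defensive.

Local Open Scope classical_set_scope.
Local Open Scope ring_scope.

(** * Exponential sums and uniqueness of closed forms *)

Definition is_expsum (R : realType) (f : R -> R) :=
  exists l : seq (R * R), forall s, f s = \sum_(p <- l) p.1 * expR (p.2 * s).

Lemma is_expsum_ext (R : realType) (f g : R -> R) :
  f =1 g -> is_expsum f -> is_expsum g.
Proof. by move=> fg [l fl]; exists l => s; rewrite -fg fl. Qed.

Lemma is_expsum_exp (R : realType) (c b : R) : is_expsum (fun s => c * expR (b * s)).
Proof. by exists [:: (c, b)] => s; rewrite big_seq1. Qed.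

Lemma is_expsumD (R : realType) (f g : R -> R) :
  is_expsum f -> is_expsum g -> is_expsum (fun s => f s + g s).
Proof. by move=> [l fl] [m gm]; exists (l ++ m) => s; rewrite big_cat fl gm. Qed.

Lemma is_expsumM (R : realType) (f g : R -> R) :
  is_expsum f -> is_expsum g -> is_expsum (fun s => f s * g s).
Proof.
move=> [l fl] [m gm].
exists [seq (p.1 * q.1, p.2 + q.2) | p <- l, q <- m] => s.
rewrite fl gm big_allpairs_dep mulr_suml; apply: eq_bigr => p _.
rewrite mulr_sumr; apply: eq_bigr => q _ /=.
by rewrite mulrDl expRD; ring.
Qed.

Lemma is_expsum0 (R : realType) : is_expsum (fun _ : R => 0).
Proof. by exists [::] => s; rewrite big_nil. Qed.

Lemma is_expsum_sum (R : realType) (I : Type) (r : seq I) (f : I -> R -> R) :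
  (forall i, is_expsum (f i)) -> is_expsum (fun s => \sum_(i <- r) f i s).
Proof.
move=> fi; elim: r => [|i r ih].
  by apply: is_expsum_ext (is_expsum0 R) => s; rewrite big_nil.
by apply: is_expsum_ext (is_expsumD (fi i) ih) => s; rewrite big_cons.
Qed.

Lemma is_expsumB (R : realType) (f g : R -> R) :
  is_expsum f -> is_expsum g -> is_expsum (fun s => f s - g s).
Proof.
move=> fe ge; have ce := is_expsum_exp (-1) (0 : R).
apply: is_expsum_ext (is_expsumD fe (is_expsumM ce ge)) => s.
by rewrite mul0r expR0; ring.
Qed.

(** Induction on the number of terms: [f (s + h) - e^(b h) * f s], where [b] is
    one of the exponents, is an exponential sum with one term less, still
    vanishing near [s0] when [h] is small. Hence it vanishes everywhere, and a
    zero of [f] propagates from [s0] to any [s] by small steps. *)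
Lemma expsum_eq0_nbhs (R : realType) (f : R -> R) (s0 : R) :
  is_expsum f -> (\forall s \near s0, f s = 0) -> forall s, f s = 0.
Proof.
move=> [l fl] /nbhs_ballP[r /= r0 fr].
move ln : (size l) => n; elim: n l ln f fl r r0 fr => [|n ih] l.
  by move=> /size0nil -> f fl _ _ _ s; rewrite fl big_nil.
case: l => // -[c b] l [ln] f fl r r0 fr s.
have step h : `|h| < r / 2 -> forall x, f (x + h) = expR (b * h) * f x.
  move=> hr x; apply/eqP; rewrite -subr_eq0; apply/eqP; move: x.
  pose m := [seq (p.1 * (expR (p.2 * h) - expR (b * h)), p.2) | p <- l].
  have r20 : 0 < r / 2 by rewrite divr_gt0.
  apply: (ih m _ _ _ (r / 2) r20) => [||x] /=; first by rewrite size_map.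
    move=> x.
    rewrite !fl !big_cons/= mulrDr !mulrDr expRD opprD addrACA.
    (* The term with exponent [b] cancels. *)
    rewrite [X in X + _](_ : _ = 0) ?add0r; last by ring.
    rewrite mulr_sumr -sumrB /m big_map; apply: eq_bigr => p _ /=.
    by rewrite mulrDr expRD; ring.
  rewrite /ball/= => xr.
  rewrite !fr ?mulr0 ?subrr// /ball/=; first by apply: lt_trans xr _; lra.
  rewrite opprD addrA; apply: le_lt_trans (ler_normB _ _) _; lra.
pose k := (Num.truncn (`|s - s0| / (r / 2))).+1.
have k0 : 0 < k%:R :> R by rewrite ltr0n.
pose h := (s - s0) / k%:R.
have hr : `|h| < r / 2.
  rewrite normrM normfV (gtr0_norm k0) ltr_pdivrMr// mulrC.
  rewrite -ltr_pdivrMr ?divr_gt0//; exact: truncnS_gt.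
have iter_h j : f (s0 + j%:R * h) = 0.
  elim: j => [|j ihj]; first by rewrite mul0r addr0 fr//; exact: ballxx.
  by rewrite -natr1 mulrDl mul1r addrA step// ihj mulr0.
by rewrite -(iter_h k) /h mulrC divfK ?gt_eqF// addrC subrK.
Qed.

Lemma eval_expsumE (R : realType) (d : nat) (E : expsum R d) (y : R) z : 0 < y ->
  eval_expsum E y z = \sum_(t <- E)
    t.1.1%:~R * expR ((pairing (latt R t.1.2) t.2 - pairing (latt R t.1.2) z) * ln y).
Proof.
move=> y0; apply: eq_bigr => t _.
by rewrite /powR gt_eqF// /pairing mulmxBr !mxE.
Qed.

Lemma pairingD (R : realType) (d : nat) (v : 'rV[R]_d) x y :
  pairing v (x + y) = pairing v x + pairing v y.
Proof. by rewrite /pairing mulmxDr mxE. Qed.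

Lemma pairingZ (R : realType) (d : nat) (v : 'rV[R]_d) a x :
  pairing v (a *: x) = a * pairing v x.
Proof. by rewrite /pairing -scalemxAr mxE. Qed.

Lemma eval_expsum_time (R : realType) (d : nat) (E : expsum R d) z :
  is_expsum (fun t => eval_expsum E (expR t) z).
Proof.
apply: is_expsum_ext (is_expsum_sum E (fun e => is_expsum_exp e.1.1%:~R
  (pairing (latt R e.1.2) e.2 - pairing (latt R e.1.2) z))) => t.
by rewrite eval_expsumE ?expR_gt0// expRK.
Qed.

Lemma eval_expsum_line (R : realType) (d : nat) (E : expsum R d) t z x :
  is_expsum (fun s => eval_expsum E (expR t) (z + s *: x)).
Proof.
apply: is_expsum_ext (is_expsum_sum E (fun e => is_expsum_exp
  (e.1.1%:~R * expR ((pairing (latt R e.1.2) e.2 - pairing (latt R e.1.2) z) * t))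
  (- pairing (latt R e.1.2) x * t))) => s.
rewrite eval_expsumE ?expR_gt0// expRK; apply: eq_bigr => e _.
by rewrite pairingD pairingZ -mulrA -expRD; congr (_ * expR _); ring.
Qed.

(** [cleared_num / cleared_den] is the sum of quotients [Q] over the common
    denominator [cleared_den]. Both stay exponential sums along suitable paths,
    which a quotient does not. *)
Fixpoint cleared_num (R : realType) (d : nat) (Q : quotsum R d) y z : R :=
  if Q is q :: Q' then
    eval_expsum q.1 y z * \prod_(q' <- Q') eval_expsum q'.2 y z
    + eval_expsum q.2 y z * cleared_num Q' y z
  else 0.

Definition cleared_den (R : realType) (d : nat) (Q : quotsum R d) y z : R :=
  \prod_(q <- Q) eval_expsum q.2 y z.

Lemma cleared_den_neq0 (R : realType) (d : nat) (Q : quotsum R d) y z :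
  defined_at Q y z -> cleared_den Q y z != 0.
Proof.
move=> [_ Qyz]; rewrite /cleared_den prodf_seq_neq0; apply/allP => q qQ /=.
exact: Qyz.
Qed.

Lemma eval_quotsum_cleared (R : realType) (d : nat) (Q : quotsum R d) y z :
  defined_at Q y z -> eval_quotsum Q y z = cleared_num Q y z / cleared_den Q y z.
Proof.
rewrite /eval_quotsum /cleared_den; elim: Q => [|q Q ih] Qyz.
  by rewrite !big_nil mul0r.
have Qyz' : defined_at Q y z.
  by split=> [|r rQ]; [exact: Qyz.1 | apply: Qyz.2; rewrite inE rQ orbT].
rewrite !big_cons /= ih//.
have q0 : eval_expsum q.2 y z != 0 by apply: Qyz.2; rewrite mem_head.
have := cleared_den_neq0 Qyz'; rewrite /cleared_den => Q0.
by field; apply/andP.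
Qed.

(** The path [s |-> (y s, z s)] stands for the two uses made below: a moving
    [ln y] with [z] fixed, and [z] moving along a line with [y] fixed. *)
Lemma is_expsum_cleared (R : realType) (d : nat) (y : R -> R) (z : R -> 'cV[R]_d)
    (yz : forall E, is_expsum (fun s => eval_expsum E (y s) (z s))) Q :
  is_expsum (fun s => cleared_den Q (y s) (z s)) /\
  is_expsum (fun s => cleared_num Q (y s) (z s)).
Proof.
elim: Q => [|q Q [ihd ihn]].
  split; last exact: is_expsum0.
  apply: is_expsum_ext (is_expsum_exp 1 0) => s.
  by rewrite /cleared_den big_nil mul0r expR0 mul1r.
split; last exact: (is_expsumD (is_expsumM (yz _) ihd) (is_expsumM (yz _) ihn)).
apply: is_expsum_ext (is_expsumM (yz q.2) ihd) => s.
by rewrite /cleared_den big_cons.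
Qed.

Lemma cvg_line (R : realType) (d : nat) (z x : 'cV[R]_d) (s0 : R) :
  z + s *: x @[s --> s0] --> z + s0 *: x.
Proof. by apply: cvgD; [exact: cvg_cst | apply: cvgZr_tmp; exact: cvg_id]. Qed.

(** Both closed forms sum the same series where it converges, so the difference
    [G] of their cross products vanishes there. It propagates in two moves: for
    [1 < y] fixed, along the line from an interior point [z0] to [z]; then, for
    [z] fixed, from [1 < y] to all positive [y]. *)
Lemma closed_form_unique (R : realType) (d : nat) (P : set 'cV[R]_d) Q1 Q2 y z :
  P° !=set0 -> is_closed_form P Q1 -> is_closed_form P Q2 ->
  defined_at Q1 y z -> defined_at Q2 y z ->
  eval_quotsum Q1 y z = eval_quotsum Q2 y z.
Proof.
move=> [z0 Pz0] [_ Q1P] [_ Q2P] Q1yz Q2yz.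
pose G y z := cleared_num Q1 y z * cleared_den Q2 y z
              - cleared_num Q2 y z * cleared_den Q1 y z.
have G_expsum (u : R -> R) (w : R -> 'cV[R]_d)
    (yz : forall E, is_expsum (fun s => eval_expsum E (u s) (w s))) :
    is_expsum (fun s => G (u s) (w s)).
  have [d1 n1] := is_expsum_cleared yz Q1.
  have [d2 n2] := is_expsum_cleared yz Q2.
  by apply: is_expsumB; exact: is_expsumM.
have G_in t x : 0 < t -> P° x -> G (expR t) x = 0.
  move=> t0 Px; have y1 : 1 < expR t by rewrite expR_gt1.
  have [D1 E1] := Q1P _ _ y1 Px; have [D2 E2] := Q2P _ _ y1 Px.
  have /eqP : eval_quotsum Q1 (expR t) x = eval_quotsum Q2 (expR t) x.
    by move: E1; rewrite E2 => -[].
  rewrite !eval_quotsum_cleared// eqr_div ?cleared_den_neq0// => /eqP e.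
  by rewrite /G e subrr.
have G_time t x : 0 < t -> G (expR t) x = 0.
  move=> t0; have := @expsum_eq0_nbhs _ (fun s => G (expR t) (z0 + s *: (x - z0))) 0.
  move=> /(_ _ _ 1); rewrite scale1r [z0 + _]addrC subrK; apply.
    by apply: (G_expsum (fun=> _)) => E; exact: eval_expsum_line.
  have /(_ P°) := @cvg_line _ _ z0 (x - z0) 0; rewrite scale0r addr0.
  move=> /(_ (open_nbhs_nbhs (conj (@open_interior _ P) Pz0))).
  by move=> Pline; near=> s; apply: G_in => //; near: s; exact: Pline.
have Gyz : G y z = 0.
  have y0 : 0 < y by exact: Q1yz.1.
  rewrite -(lnK y0); apply: (@expsum_eq0_nbhs _ (fun t => G (expR t) z) 1).
    by apply: (G_expsum _ (fun=> _)) => E; exact: eval_expsum_time.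
  near=> t; apply: G_time; near: t; exact: (lt_nbhsr ltr01).
rewrite !eval_quotsum_cleared//; apply/eqP; rewrite eqr_div ?cleared_den_neq0//.
by rewrite -subr_eq0; apply/eqP.
Unshelve. all: by end_near. Qed.

(** * Polytopes and their minimisers *)

(** Points of the hull of a finite set may use a generator several times;
    collecting the weights writes them over one fixed family, which is what the
    simultaneous combinations below require. *)
Lemma polytope_generators (R : realType) (d : nat) (P : set 'cV[R]_d) :
  is_polytope P -> exists n (a : 'I_n -> 'cV[R]_d), forall x,
    P x <-> exists w : 'I_n -> R,
      [/\ forall i, 0 <= w i, \sum_i w i = 1 & x = \sum_i w i *: a i].
Proof.
move=> [A /finite_seqP[s ->] ->].
exists (size s), (fun i => tnth (in_tuple s) i) => x; split; last first.
  by move=> [w [w0 w1 ->]]; exists (size s), w, (tnth (in_tuple s)); split => // i;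
    exact: mem_tnth.
move=> [m [w [b [bs w0 w1 ->]]]].
have idx i : (index (b i) s < size s)%N by rewrite index_mem; exact: bs.
pose h i := Ordinal (idx i).
exists (fun k => \sum_(i | h i == k) w i); split => [k||].
- exact: sumr_ge0.
- by rewrite -w1 (partition_big h xpredT).
- rewrite (partition_big h xpredT)//=; apply: eq_bigr => k _.
  rewrite scaler_suml; apply: eq_bigr => i /eqP <-.
  by rewrite (tnth_nth 0) nth_index//; exact: bs.
Qed.

Lemma affine_generators (R : realType) (d : nat) (P : set 'cV[R]_d)
    n (a : 'I_n -> 'cV[R]_d) :
  (forall x, P x -> exists w : 'I_n -> R,
      [/\ forall i, 0 <= w i, \sum_i w i = 1 & x = \sum_i w i *: a i]) ->
  full_dimensional P ->
  forall x, exists2 w : 'I_n -> R, \sum_i w i = 1 & x = \sum_i w i *: a i.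
Proof.
move=> Pa fullP x; have [m [w [b [bP w1 xE]]]] : affine_hull P x by rewrite fullP.
have /choice[W WP] : forall j, exists W : 'I_n -> R,
    \sum_i W i = 1 /\ b j = \sum_i W i *: a i.
  by move=> j; have [W [_ ? ?]] := Pa _ (bP j); exists W.
exists (fun i => \sum_j w j * W j i).
  rewrite exchange_big -w1; apply: eq_bigr => j _.
  by rewrite -mulr_sumr (WP j).1 mulr1.
rewrite xE; under eq_bigr do rewrite (WP _).2 scaler_sumr.
rewrite exchange_big; apply: eq_bigr => i _; rewrite scaler_suml.
by apply: eq_bigr => j _; rewrite scalerA.
Qed.

(** The barycentre [c] of the generators is interior. Since they span affinely,
    each basis vector is a combination of them with weights [W j] of sum 0; so a
    small displacement of [c] perturbs the positive weights [1/n] by a small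
    amount, keeping them nonnegative and of sum 1. *)
Lemma full_polytope_interior (R : realType) (d : nat) (P : set 'cV[R]_d) :
  is_polytope P -> full_dimensional P -> P° !=set0.
Proof.
move=> /polytope_generators[n [a Pa]] fullP.
have aff := affine_generators (fun x => (Pa x).1) fullP.
have n0 : 0 < n%:R :> R.
  have [w w1 _] := aff 0; rewrite ltr0n lt0n; apply: contra_eq_neq w1 => n0.
  rewrite big1 => [|i _]; first by rewrite eq_sym oner_eq0.
  by have := ltn_ord i; rewrite [X in (_ < X)%N]n0.
have /choice[W WP] : forall j : 'I_d, exists W : 'I_n -> R,
    \sum_i W i = 0 /\ delta_mx j 0 = \sum_i W i *: a i.
  move=> j; have [w w1 wE] := aff (delta_mx j 0); have [v v1 vE] := aff 0.
  exists (fun i => w i - v i); split; first by rewrite sumrB w1 v1 subrr.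
  by under eq_bigr do rewrite scalerBl; rewrite sumrB -wE -vE subr0.
pose M := 1 + \sum_i \sum_j `|W j i|.
have M0 : 0 < M.
  by rewrite ltr_wpDr// sumr_ge0// => i _; rewrite sumr_ge0.
pose c := \sum_i n%:R^-1 *: a i.
exists c; rewrite /interior; apply/nbhs_ballP; exists (n%:R * M)^-1 => /=.
  by rewrite invr_gt0 mulr_gt0.
move=> x [_ cx]; pose y := x - c.
have yb j : `|y j 0| < (n%:R * M)^-1.
  by have := cx j 0; rewrite /ball/= distrC /y !mxE.
apply/Pa; exists (fun i => n%:R^-1 + \sum_j y j 0 * W j i); split => [i||].
- have : `|\sum_j y j 0 * W j i| <= n%:R^-1.
    apply: le_trans (ler_norm_sum _ _ _) _.
    apply: (@le_trans _ _ (\sum_j (n%:R * M)^-1 * `|W j i|)).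
      by apply: ler_sum => j _; rewrite normrM ler_wpM2r// ltW.
    rewrite -mulr_sumr invfM -mulrA.
    rewrite ler_piMr ?(ltW n0) ?invr_ge0 ?(ltW n0)//.
    rewrite mulrC ler_pdivrMr// mul1r /M (bigD1 i)//= addrCA lerDl addr_ge0//.
    by rewrite sumr_ge0// => k _; rewrite sumr_ge0.
  by rewrite ler_norml => /andP[h _]; rewrite -lerBlDl sub0r.
- rewrite big_split/= sumr_const card_ord -[_ *+ n]mulr_natr mulVf ?gt_eqF//.
  rewrite exchange_big big1 ?addr0// => j _.
  by rewrite -mulr_sumr (WP j).1 mulr0.
- rewrite (_ : x = c + y); last by rewrite /y addrC subrK.
  have {1}-> : y = \sum_j y j 0 *: delta_mx j 0.
    rewrite [LHS]matrix_sum_delta; apply: eq_bigr => j _.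
    by rewrite big_ord1.
  rewrite /c; under [in RHS]eq_bigr do rewrite scalerDl.
  rewrite big_split/=; congr (_ + _).
  under eq_bigr do rewrite (WP _).2 scaler_sumr.
  rewrite exchange_big; apply: eq_bigr => i _; rewrite scaler_suml.
  by apply: eq_bigr => j _; rewrite scalerA.
Qed.

Definition minimizes (R : realType) (d : nat) (P : set 'cV[R]_d) v p :=
  P p /\ forall x, P x -> pairing v p <= pairing v x.

Lemma pairing_sum (R : realType) (d : nat) (v : 'rV[R]_d) n (w : 'I_n -> R) a :
  pairing v (\sum_i w i *: a i) = \sum_i w i * pairing v (a i).
Proof.
rewrite /pairing mulmx_sumr summxE; apply: eq_bigr => i _.
by rewrite -scalemxAr mxE.
Qed.

Lemma polytope_minimizer (R : realType) (d : nat) (P : set 'cV[R]_d) v :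
  is_polytope P -> P !=set0 -> exists p, minimizes P v p.
Proof.
move=> /polytope_generators[n [a Pa]] [x0 /Pa[w0 [_ w01 _]]].
have [i0 _] : exists i : 'I_n, true.
  apply: contrapT => no; move/eqP: w01; rewrite big1 => [|i _].
    by rewrite eq_sym oner_eq0.
  by case: no; exists i.
pose i := [arg min_(i < i0) pairing v (a i)]%O.
exists (a i); split.
  apply/Pa; exists (fun k => (k == i)%:R); split => [k||].
  - by case: eqP.
  - by rewrite (bigD1 i)//= eqxx big1 ?addr0// => k /negbTE ->.
  - rewrite (bigD1 i)//= eqxx scale1r big1 ?addr0// => k /negbTE ->.
    by rewrite scale0r.
move=> x /Pa[w [wge w1 ->]]; rewrite pairing_sum -[leLHS]mul1r -w1 mulr_suml.
apply: ler_sum => k _; apply: ler_wpM2l => //.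
by rewrite /i; case: arg_minP => // j _; apply.
Qed.

Lemma min_on_minimizes (R : realType) (d : nat) (P : set 'cV[R]_d) v p :
  minimizes P v p -> min_on P v = pairing v p.
Proof.
move=> [Pp pmin]; apply/eqP; rewrite eq_le; apply/andP; split.
  by apply: ge_inf; [exists (pairing v p) => _ [x Px <-]; exact: pmin | exists p].
by apply: lb_le_inf; [exists (pairing v p), p | move=> _ [x Px <-]; exact: pmin].
Qed.

Lemma supp_fun_minimizes (R : realType) (d : nat) (P : set 'cV[R]_d) v p z :
  minimizes P v p -> supp_fun (translate P z) v = - pairing v (p - z).
Proof.
move=> [Pp pmin]; congr (- _); apply: min_on_minimizes; split.
  by exists p.
by move=> _ [x Px <-]; rewrite !pairingD lerD2r pmin.
Qed.

Lemma min_on_eq_minimizes (R : realType) (d : nat) (P : set 'cV[R]_d) v p :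
  is_polytope P -> P p -> min_on P v = pairing v p -> minimizes P v p.
Proof.
move=> Ppol Pp vp; split=> // x Px.
have [q qmin] := polytope_minimizer v Ppol (ex_intro _ x Px).
by rewrite -vp (min_on_minimizes qmin) qmin.2.
Qed.

Lemma pairing_is_scalar (R : realType) (d : nat) (v : 'rV[R]_d) :
  scalar (pairing v).
Proof. by move=> a x y; rewrite pairingD pairingZ. Qed.

HB.instance Definition _ (R : realType) (d : nat) (v : 'rV[R]_d) :=
  GRing.isLinear.Build R 'cV[R]_d R *%R (pairing v) (pairing_is_scalar v).

Lemma normal_fan_complete (R : realType) (d : nat) (P : set 'cV[R]_d) :
  is_polytope P -> P !=set0 -> \bigcup_(C in normal_fan P) C = setT.
Proof.
move=> Ppol P0; rewrite -subTset => v _.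
have [p pmin] := polytope_minimizer v Ppol P0.
pose F := [set x | P x /\ forall y, P y -> pairing v x <= pairing v y].
exists (normal_cone P F).
  by exists F => //; split; [exists p | exists (pairing v)].
by move=> q qF; exact: min_on_minimizes.
Qed.

Lemma normal_cone_minimizes (R : realType) (d : nat) (P : set 'cV[R]_d) C :
  is_polytope P -> normal_fan P C -> exists p, forall v, C v -> minimizes P v p.
Proof.
move=> Ppol [F [[p Fp] [l FE]] <-]; exists p => v vF.
by apply: min_on_eq_minimizes => //; [move: Fp; rewrite FE => -[] | exact: vF].
Qed.

(** From an interior point one can still decrease [v] inside [P], by moving in
    the direction [- v^T]. *)
Lemma interior_pairing_lt0 (R : realType) (d : nat) (P : set 'cV[R]_d) v p z :
  v != 0 -> P° z -> minimizes P v p -> pairing v (p - z) < 0.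
Proof.
move=> v0 Pz [Pp pmin].
have vv : 0 < pairing v v^T.
  rewrite /pairing mxE lt_def sumr_ge0 ?andbT; last first.
    by move=> j _; rewrite mxE -expr2 sqr_ge0.
  apply: contra v0; rewrite psumr_eq0 => [|j _]; last by rewrite mxE -expr2 sqr_ge0.
  move=> /allP v0; apply/eqP/rowP => j; rewrite mxE.
  by have := v0 j (mem_index_enum j); rewrite /= mxE mulf_eq0 orbb => /eqP.
have /(_ P) := @cvg_line _ _ z (- v^T) 0; rewrite scale0r addr0 => /(_ Pz).
move=> /nbhs_ballP[r /= r0 rP].
have : P (z + (r / 2) *: - v^T).
  apply: rP; rewrite /ball/= sub0r normrN gtr0_norm ?divr_gt0//.
  by rewrite ltr_pdivrMr// ltr_pMr// ltr1n.
move=> /pmin; rewrite pairingD pairingZ (raddfN (pairing v)) /= => h.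
rewrite pairingD (raddfN (pairing v)) /= subr_lt0; apply: le_lt_trans h _.
by rewrite mulrN gtrBl mulr_gt0// divr_gt0.
Qed.

(** * Half-open simplicial cones *)

(** Along the moment curve [(1, t, t^2, ..)] each linear form is a nonzero
    polynomial in [t]; a value of [t] is chosen that is a root of none. *)
Lemma generic_direction (R : realType) (d : nat) (I : finType) (v : I -> 'cV[R]_d) :
  (forall i, v i != 0) -> exists x : 'rV[R]_d, forall i, (x *m v i) 0 0 != 0.
Proof.
move=> v0; pose p := \prod_i rVpoly (v i)^T.
have p0 : p != 0.
  apply/prodf_neq0 => i _; apply: contra (v0 i) => /eqP vi.
  by rewrite -(trmxK (v i)) -[X in X^T](rVpolyK) vi linear0 trmx0.
have [t pt] : exists t, p.[t] != 0.
  apply: contrapT => no.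
  have := max_poly_roots (rs := [seq n%:R | n <- iota 0 (size p)]) p0.
  rewrite size_map size_iota ltnn => /(_ _ _)/negP; apply=> //.
    apply/allP => t _; apply/rootP/eqP; apply: contrapT => /negP h; apply: no.
    by exists t.
  by rewrite map_inj_uniq ?iota_uniq//; apply: mulrIn; exact: oner_neq0.
exists (\row_j t ^+ j) => i.
move: pt; rewrite horner_prod => /prodf_neq0/(_ i isT); apply: contra => /eqP <-.
rewrite /rVpoly horner_poly mxE; apply/eqP; apply: eq_bigr => j _.
by rewrite valK !mxE mulrC.
Qed.

Definition real_mx (R : realType) (d : nat) (U : 'M[int]_d) : 'M[R]_d := map_mx intr U.

Definition coord (R : realType) (d : nat) (U : 'M[int]_d) (v : 'rV[R]_d) : 'rV[R]_d :=
  v *m invmx (real_mx R U).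

Lemma real_mx_unit (R : realType) (d : nat) (U : 'M[int]_d) :
  \det U != 0 -> real_mx R U \in unitmx.
Proof. by move=> U0; rewrite unitmxE unitfE det_map_mx intr_eq0. Qed.

Lemma sum_latt (R : realType) (d : nat) (U : 'M[int]_d) (c : 'rV[R]_d) :
  \sum_k c 0 k *: latt R (row k U) = c *m real_mx R U.
Proof.
rewrite mulmx_sum_row; apply: eq_bigr => k _; congr (_ *: _).
by apply/rowP => j; rewrite !mxE.
Qed.

Lemma coord_sum (R : realType) (d : nat) (U : 'M[int]_d) (v : 'rV[R]_d) :
  \det U != 0 -> v = \sum_k coord U v 0 k *: latt R (row k U).
Proof. by move=> U0; rewrite sum_latt mulmxKV// real_mx_unit. Qed.

Lemma coord_mul (R : realType) (d : nat) (U : 'M[int]_d) (c : 'rV[R]_d) :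
  \det U != 0 -> coord U (c *m real_mx R U) = c.
Proof. by move=> U0; rewrite /coord mulmxK// real_mx_unit. Qed.

Lemma coordDZ (R : realType) (d : nat) (U : 'M[int]_d) (v w : 'rV[R]_d) a k :
  coord U (v + a *: w) 0 k = coord U v 0 k + a * coord U w 0 k.
Proof. by rewrite /coord mulmxDl -scalemxAl mxE [X in _ + X]mxE. Qed.

Lemma coordD (R : realType) (d : nat) (U : 'M[int]_d) (v w : 'rV[R]_d) :
  coord U (v + w) = coord U v + coord U w.
Proof. exact: mulmxDl. Qed.

Lemma coordZ (R : realType) (d : nat) (U : 'M[int]_d) a (v : 'rV[R]_d) :
  coord U (a *: v) = a *: coord U v.
Proof. by rewrite /coord -scalemxAl. Qed.

Lemma coneP (R : realType) (d : nat) (U : 'M[int]_d) (v : 'rV[R]_d) :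
  \det U != 0 -> cone U v <-> forall k, 0 <= coord U v 0 k.
Proof.
move=> U0; split=> [[c c0 <-] k|v0].
  have -> : \sum_k c k *: latt R (row k U)
      = \sum_k (\row_k c k) 0 k *: latt R (row k U).
    by apply: eq_bigr => j _; rewrite mxE.
  by rewrite sum_latt coord_mul// mxE; exact: c0.
by exists (coord U v 0) => //; rewrite -coord_sum.
Qed.

Lemma cone_row (R : realType) (d : nat) (U : 'M[int]_d) k : @cone R d U (latt R (row k U)).
Proof.
exists (fun j => (j == k)%:R); first by move=> j /=; case: eqP.
by rewrite (bigD1 k)//= eqxx scale1r big1 ?addr0// => j /negbTE ->; rewrite scale0r.
Qed.

(** A linear form whose minimum on a cone is reached at an interior point is zero
    on the cone: its value there is 0 by homogeneity, and is a positive
    combination of its nonnegative values on the generators. *)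
Lemma face_meets_interior (R : realType) (d : nat) (U : 'M[int]_d)
    (F : set 'rV[R]_d) x :
  \det U != 0 -> is_face F (cone U) -> F x -> (forall k, 0 < coord U x 0 k) ->
  cone U `<=` F.
Proof.
move=> U0 [_ [l FE]]; rewrite FE => -[_ lx] x0.
have coneZ (a : R) v : 0 <= a -> cone U v -> cone U (a *: v).
  by move=> a0 /(coneP _ U0) v0; apply/coneP => // k; rewrite coordZ mxE mulr_ge0.
have Cx : cone U x by apply/coneP => // k; exact: ltW.
have lx0 : l x = 0.
  apply/eqP; rewrite eq_le; apply/andP; split.
    by have := lx _ (coneZ 0 x (lexx _) Cx); rewrite linearZ /= mul0r.
  have := lx _ (coneZ 2%:R x (ler0n _ _) Cx); rewrite linearZ /=.
  by rewrite mulr_natl mulr2n lerDl.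
pose u k := latt R (row k U).
have Cu k : cone U (u k) by exact: cone_row.
have lu k : l (u k) = 0.
  have : \sum_k coord U x 0 k * l (u k) == 0.
    rewrite -[X in _ == X]lx0 {2}(coord_sum x U0) linear_sum /=; apply/eqP.
    by apply: eq_bigr => j _; rewrite linearZ.
  rewrite psumr_eq0 => [/allP/(_ k (mem_index_enum k))/=|j _].
    by rewrite mulf_eq0 gt_eqF//= => /eqP.
  by rewrite mulr_ge0 ?(ltW (x0 j))// -lx0; exact: lx.
move=> y Cy; split=> // w Cw.
suff lC v : l v = 0 by rewrite !lC.
by rewrite (coord_sum v U0) linear_sum big1// => k _; rewrite linearZ /= lu mulr0.
Qed.

Definition pos (R : realType) (closed : bool) (c : R) : bool :=
  if closed then 0 <= c else 0 < c.

(** The points that enter the cone when pushed slightly in the direction [x]: a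
    facet is kept exactly when [x] points inwards across it. *)
Definition half_open (R : realType) (d : nat) (x : 'rV[R]_d) (U : 'M[int]_d) :
    set 'rV[R]_d :=
  [set v | forall k, pos (0 < coord U x 0 k) (coord U v 0 k)].

Lemma half_open_near (R : realType) (d : nat) (x v : 'rV[R]_d) (U : 'M[int]_d) :
  half_open x U v ->
  \forall e \near 0^'+, forall k, 0 < coord U (v + e *: x) 0 k.
Proof.
move=> xv; apply: filter_forall => k; have := xv k.
rewrite /pos; case: ltP => [xk vk|xk vk].
  by near=> e; rewrite coordDZ ltr_wpDl// mulr_gt0.
have e0 : 0 < coord U v 0 k / (1 - coord U x 0 k).
  by rewrite divr_gt0// ltr_wpDr// oppr_ge0.
near=> e; rewrite coordDZ.
have : e < coord U v 0 k / (1 - coord U x 0 k) by near: e; exact: nbhs_right_lt.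
rewrite ltr_pdivlMr; last by rewrite ltr_wpDr// oppr_ge0.
have : 0 < e by near: e; exact: nbhs_right_gt.
by rewrite mulrBr mulr1 => ? ?; lra.
Unshelve. all: by end_near. Qed.

Lemma not_half_open_near (R : realType) (d : nat) (x v : 'rV[R]_d) (U : 'M[int]_d) :
  \det U != 0 -> (forall k, coord U x 0 k != 0) -> ~ half_open x U v ->
  \forall e \near 0^'+, ~ cone U (v + e *: x).
Proof.
move=> U0 x0 /existsNP[k /negP vk].
suff : \forall e \near 0^'+, coord U (v + e *: x) 0 k < 0.
  apply: filterS => e ek /(coneP _ U0)/(_ k).
  by rewrite leNgt ek.
move: vk; rewrite /pos; case: ltgtP (x0 k) => // [xk|xk] _.
  rewrite -ltNge => vk.
  have e0 : 0 < - coord U v 0 k / coord U x 0 k by rewrite divr_gt0// oppr_gt0.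
  near=> e; rewrite coordDZ.
  have : e < - coord U v 0 k / coord U x 0 k by near: e; exact: nbhs_right_lt.
  by rewrite ltr_pdivlMr// => ?; lra.
rewrite -leNgt => vk.
near=> e; rewrite coordDZ.
have e0 : 0 < e by near: e; exact: nbhs_right_gt.
have : e * coord U x 0 k < 0 by rewrite pmulr_rlt0.
lra.
Unshelve. all: by end_near. Qed.

(** For small [e > 0] the point [v + e *: x] lies in some cone, since the cones
    cover; the same cone serves for arbitrarily small [e], so [v] is in its
    half-open version. If two half-open cones contained [v], then [v + e *: x]
    would be interior to both cones for some [e]; as they meet along a common
    face, they would coincide. *)
Lemma half_open_partition (R : realType) (d : nat) N (T : 'I_N -> 'M[int]_d)
    (x : 'rV[R]_d) :
  (forall i, \det (T i) != 0) -> (forall i k, coord (T i) x 0 k != 0) ->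
  injective (fun i => @cone R d (T i)) ->
  (forall i j, is_face (@cone R d (T i) `&` @cone R d (T j)) (cone (T i))) ->
  \bigcup_i @cone R d (T i) = setT ->
  forall v, exists i, forall j, half_open x (T j) v <-> j = i.
Proof.
move=> T0 x0 Tinj Tface Tcover v.
have [i iv] : exists i, half_open x (T i) v.
  apply: contrapT => no.
  have : \forall e \near 0^'+, forall i, ~ cone (T i) (v + e *: x).
    apply: filter_forall => i; apply: not_half_open_near => //.
    by move=> iv; apply: no; exists i.
  move=> /(@filter_ex _ _ _ _)[e eT].
  have : (\bigcup_i @cone R d (T i)) (v + e *: x) by rewrite Tcover.
  by move=> [i _]; exact: eT.
exists i => j; split=> [jv|-> //].
have [e [ei ej]] := @filter_ex _ _ _ _
  (filterI (half_open_near iv) (half_open_near jv)).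
have sub k l : (forall m, 0 < coord (T k) (v + e *: x) 0 m) ->
    (forall m, 0 < coord (T l) (v + e *: x) 0 m) -> @cone R d (T k) `<=` cone (T l).
  move=> k0 l0 w kw; apply: (@face_meets_interior _ _ _ _ _ (T0 k) (Tface k l) _ k0 _ kw).2.
  by split; apply/coneP => // m; exact: ltW.
by apply: Tinj; rewrite eqEsubset; split; exact: sub.
Qed.

(** * Lattice points of a half-open cone *)

Lemma absz_unit_det (d : nat) (L : 'M[int]_d) : L \in unitmx -> `|\det L|%N = 1%N.
Proof. by rewrite unitmxE => /orP[] /eqP ->. Qed.

(** The rows of [U] span a sublattice of index [|det U|]. With the Smith normal
    form [U = L *m diag E *m S], the change of basis [S] turns the sublattice
    into the product of the [E_k Z], for which the digits [0 <= b_k < |E_k|] are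
    representatives. *)
Lemma lattice_transversal (d : nat) (U : 'M[int]_d) : \det U != 0 ->
  exists s : seq 'rV[int]_d,
    [/\ size s = `|\det U|%N, uniq s,
        forall x, exists2 b, b \in s & exists m, x = b + m *m U
      & forall b b' m, b \in s -> b' \in s -> b = b' + m *m U -> b = b'].
Proof.
move=> U0; have [L Lu [S Su [e _ UE]]] := int_Smith_normal_form U.
pose E : 'rV[int]_d := \row_k e`_k.
have {}UE : U = L *m diag_mx E *m S.
  by rewrite UE; congr (_ *m _ *m _); apply/matrixP => i j; rewrite !mxE.
pose n k := `|E 0%R k|%N.
have detU : `|\det U|%N = (\prod_k n k)%N.
  rewrite UE !det_mulmx !abszM (absz_unit_det Lu) (absz_unit_det Su) mul1n muln1 det_diag.
  by apply: (big_morph absz abszM).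
have E0 k : E 0 k != 0.
  rewrite -absz_gt0; move: U0; rewrite -absz_gt0 detU (bigD1 k)//= muln_gt0.
  by case/andP.
pose box := {dffun forall k : 'I_d, 'I_(n k)}.
pose digits (f : box) : 'rV[int]_d := \row_k (f k : nat)%:Z.
have digits_mod (f : box) k : (digits f 0%R k %% E 0%R k)%Z = digits f 0 k.
  have fk : 0 <= digits f 0 k < (n k)%:Z.
    by rewrite mxE lez_nat leq0n ltz_nat; exact: (ltn_ord (f k)).
  by rewrite -modz_abs modz_small.
have digits_inj : injective digits.
  move=> f g fg; apply/ffunP => k; apply/val_inj.
  by have /rowP/(_ k) := fg; rewrite !mxE => -[].
have sep (f g : box) m : digits f *m S = digits g *m S + m *m U -> f = g.
  rewrite UE !mulmxA -mulmxDl => /(can_inj (mulmxK Su)) fg.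
  apply: digits_inj; apply/rowP => k; rewrite -digits_mod -[RHS]digits_mod.
  rewrite fg mul_mx_diag [X in (X %% _)%Z]mxE [X in (_ + X)]mxE.
  by rewrite addrC modzMDl.
have inS : injective (fun f : box => digits f *m S).
  by move=> f g /(can_inj (mulmxK Su)); exact: digits_inj.
exists [seq digits f *m S | f <- enum [set: box]%SET]; split.
- rewrite size_map -cardE cardsT card_dep_ffun detU foldrE big_map big_enum.
  by apply: eq_bigr => k _; rewrite card_ord.
- by rewrite map_inj_uniq ?enum_uniq.
- move=> x; pose x' := x *m invmx S.
  have dig k : (`|(x' 0%R k %% E 0%R k)%Z| < n k)%N.
    by rewrite -ltz_nat gez0_abs ?modz_ge0// ltz_mod.
  exists (digits [ffun k => Ordinal (dig k)] *m S).
    by apply: map_f; rewrite mem_enum inE.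
  exists ((\row_k (x' 0%R k %/ E 0%R k)%Z) *m invmx L).
  rewrite UE !mulmxA mulmxKV// -mulmxDl -[LHS](mulmxKV Su); congr (_ *m _).
  apply/rowP => k; rewrite -/x' mul_mx_diag [RHS]mxE [X in X + _]mxE [X in _ + X]mxE.
  rewrite [X in _ + X * _]mxE ffunE/= gez0_abs ?modz_ge0//.
  by rewrite [LHS](divz_eq _ (E 0 k)) addrC.
- move=> _ _ m /mapP[f _ ->] /mapP[g _ ->] fg.
  by rewrite (sep f g m fg).
Qed.

Lemma pos_le (R : realType) s (a b : R) : a <= b -> pos s a -> pos s b.
Proof. by case: s => ab h; [exact: le_trans h ab | exact: lt_le_trans h ab]. Qed.

(** The interval [0 <= a < 1] or [0 < a <= 1], according to [s]: a fundamental
    domain of the translations by integers on the real line, contained in the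
    half-line [pos s]. *)
Definition unit_part (R : realType) s (a : R) := pos s a && ~~ pos s (a - 1).

Lemma unit_part_digit (R : realType) s (a : R) : exists n : int, unit_part s (a - n%:~R).
Proof.
case: s; rewrite /unit_part /pos.
  have /andP[] := floor_itv a; rewrite intrD => fa af.
  by exists (Num.floor a); lra.
have /andP[] := ceil_itv a; rewrite intrB => ca ac.
by exists (Num.ceil a - 1); rewrite intrB; lra.
Qed.

Lemma unit_part_unique (R : realType) s (a b : R) (n : int) :
  unit_part s a -> unit_part s b -> a = b + n%:~R -> n = 0.
Proof.
move=> /andP[a0 a1] /andP[b0 b1] ab; apply/eqP; case: ltgtP => // n0.
- have : n%:~R <= (-1)%:~R :> R by rewrite ler_int -ltzD1 addrC subrr.
  by move=> h; case/negP: b1; apply: pos_le a0; rewrite ab; lra.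
- have : 1%:~R <= n%:~R :> R by rewrite ler_int -ltzD1 ltrDr.
  by move=> h; case/negP: a1; apply: pos_le b0; rewrite ab; lra.
Qed.

Lemma coord_latt_shift (R : realType) (d : nat) (U : 'M[int]_d) (v m : 'rV[int]_d) k :
  \det U != 0 ->
  coord U (latt R (v + m *m U)) 0 k = coord U (latt R v) 0 k + (m 0 k)%:~R.
Proof.
move=> U0; rewrite /latt map_mxD map_mxM coordD mxE; congr (_ + _).
by rewrite coord_mul// mxE.
Qed.

(** The half-open parallelepiped is a fundamental domain of the sublattice, so
    its lattice points are in bijection with any transversal. *)
Lemma parallelepiped_points (R : realType) (d : nat) (U : 'M[int]_d)
    (s : 'I_d -> bool) : \det U != 0 ->
  exists W : seq 'rV[int]_d, [/\ size W = `|\det U|%N, uniq W &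
    forall v, v \in W <-> forall k, unit_part (s k) (coord U (latt R v) 0 k)].
Proof.
move=> U0; have [B [Bsize Buniq Bcover Bsep]] := lattice_transversal U0.
have reduce v : exists w, (exists m, w = v + m *m U) /\
    forall k, unit_part (s k) (coord U (latt R w) 0 k).
  have /choice[n nP] := fun k => unit_part_digit (s k) (coord U (latt R v) 0 k).
  exists (v + (\row_k - n k) *m U); split; first by exists (\row_k - n k).
  by move=> k; rewrite coord_latt_shift// [X in X%:~R]mxE rmorphN; exact: nP.
have /choice[r rP] := reduce.
exists (map r B); split; first by rewrite size_map.
  rewrite map_inj_in_uniq// => b b' bB b'B.
  have [[m ->] _] := rP b; have [[m' ->] _] := rP b' => bb'.
  apply: (Bsep _ _ (m' - m)) => //.
  by rewrite mulmxBl addrA -bb' addrK.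
move=> v; split=> [/mapP[b _ ->]|vP]; first exact: (rP b).2.
have [b bB [m vE]] := Bcover v.
have [[m' rE] ru] := rP b.
suff mm : m' = m by apply/mapP; exists b; rewrite // rE mm -vE.
apply/rowP => k; apply/eqP; rewrite -subr_eq0; apply/eqP.
apply: (unit_part_unique (ru k) (vP k)).
by rewrite rE vE !coord_latt_shift// rmorphB/=; ring.
Qed.

Lemma esum_geometric (R : realType) (a r : R) : 0 <= a -> 0 <= r < 1 ->
  (\esum_(n in [set: nat]) (a * r ^+ n)%:E = (a / (1 - r))%:E)%E.
Proof.
move=> a0 /andP[r0 r1].
rewrite -nneseries_esumT => [|n]; last by rewrite lee_fin mulr_ge0// exprn_ge0.
apply/cvg_lim => //.
have := @cvg_geometric_series R a r; rewrite ger0_norm// => /(_ r1) h.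
apply: cvg_EFin; first by apply: nearW => n; rewrite sumEFin.
by apply: cvg_trans h; apply: near_eq_cvg; apply: nearW => n; rewrite /= sumEFin.
Qed.

(** The lattice sum over a half-open cone is computed one generator at a time:
    [reduced j] consists of the lattice points of the cone whose first [j]
    coordinates are in the unit interval, so that [reduced 0] is the whole
    half-open cone and [reduced d] the parallelepiped. *)

Section HalfOpenSum.
Variables (R : realType) (d : nat) (U : 'M[int]_d) (s : 'I_d -> bool).
Hypothesis U0 : \det U != 0.
Variables (f : 'rV[int]_d -> R) (r : 'I_d -> R).

Definition reduced j : set 'rV[int]_d :=
  [set v | forall k : 'I_d, pos (s k) (coord U (latt R v) 0 k) /\
     ((k < j)%N -> ~~ pos (s k) (coord U (latt R v) 0 k - 1))].

Hypothesis f_ge0 : forall v, 0 <= f v.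
Hypothesis r01 : forall k, 0 <= r k < 1.
Hypothesis f_shift : forall v k n, reduced 0 v ->
  f (v + n%:Z *: row k U) = f v * r k ^+ n.

Lemma coord_shift_row v k n j :
  coord U (latt R (v + n *: row k U)) 0 j
  = coord U (latt R v) 0 j + (n *+ (j == k))%:~R.
Proof.
rewrite rowE scalemxAl coord_latt_shift//; congr (_ + _%:~R).
by rewrite !mxE eqxx /=; case: eqP; rewrite /= ?mulr1 ?mulr0.
Qed.

(** Euclidean division of the coordinate [k]: its integral part is nonnegative
    because the coordinate itself is in the half-line. *)
Lemma reduced_bij (k : 'I_d) :
  set_bij (reduced k.+1 `*` [set: nat]) (reduced k)
          (fun p => p.1 + p.2%:Z *: row k U).
Proof.
have red_unit v : reduced k.+1 v -> unit_part (s k) (coord U (latt R v) 0 k).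
  by move=> /(_ k)[h1 h2]; rewrite /unit_part h1 h2.
split.
- move=> [v n] [/= vr _] j; rewrite coord_shift_row.
  have [->|jk] := eqVneq j k.
    rewrite ltnn; split=> //; apply: pos_le (vr k).1.
    by rewrite lerDl ler0z.
  rewrite addr0; split; first exact: (vr j).1.
  by move=> h; apply: (vr j).2; rewrite ltnS ltnW.
- move=> [v n] [v' n']; rewrite !inE/= => -[vr _] [v'r _] e.
  have : (n%:Z - n'%:Z) = 0.
    apply: (unit_part_unique (red_unit _ v'r) (red_unit _ vr)).
    have := congr1 (fun w => coord U (latt R w) 0 k) e.
    rewrite !coord_shift_row eqxx !mulr1n rmorphB/= => h.
    by rewrite addrA h; ring.
  move=> /eqP; rewrite subr_eq0 => /eqP[nn]; move: e; rewrite nn.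
  by move=> /addIr ->.
- move=> v vr; have [n nP] := unit_part_digit (s k) (coord U (latt R v) 0 k).
  have n0 : 0 <= n.
    rewrite leNgt; apply/negP => n0; case/andP: nP => _ /negP; apply.
    apply: pos_le (vr k).1.
    have : n%:~R <= (-1)%:~R :> R by rewrite ler_int -ltzD1 addrC subrr.
    by move=> h; lra.
  exists (v - n *: row k U, `|n|%N); last by rewrite /= gez0_abs// subrK.
  split=> //= j; rewrite -scaleNr coord_shift_row.
  have [->|jk] := eqVneq j k.
    by rewrite mulr1n rmorphN; case/andP: nP.
  rewrite addr0; split; first exact: (vr j).1.
  by rewrite ltnS leq_eqVlt val_eqE (negbTE jk); exact: (vr j).2.
Qed.

Lemma reduced_sub0 j : reduced j `<=` reduced 0.
Proof. by move=> v vr k; split=> //; exact: (vr k).1. Qed.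

Lemma esum_reduced_step (k : 'I_d) (c : R) : 0 <= c ->
  (\esum_(v in reduced k) (f v * c)%:E =
   \esum_(v in reduced k.+1) (f v * (c / (1 - r k)))%:E)%E.
Proof.
move=> c0; rewrite (reindex_esum _ _ _ _ (reduced_bij k)).
rewrite -(@esum_esum _ _ _ (reduced k.+1) (fun=> setT)
  (fun v n => (f (v + n%:Z *: row k U) * c)%:E)); last first.
  by move=> *; rewrite lee_fin mulr_ge0.
apply: eq_esum => v vr; rewrite mulrA -esum_geometric ?mulr_ge0//.
apply: eq_esum => n _; rewrite f_shift; last exact: reduced_sub0 vr.
by congr (_%:E); ring.
Qed.

(** Each generator contributes a geometric series, hence one factor of the
    denominator; what remains is the finite sum over the parallelepiped. *)
Lemma esum_half_open W : uniq W ->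
  (forall v, v \in W <-> forall k, unit_part (s k) (coord U (latt R v) 0 k)) ->
  (\esum_(v in [set v | forall k, pos (s k) (coord U (latt R v) 0%R k)]) (f v)%:E =
   ((\sum_(w <- W) f w) / \prod_k (1 - r k))%:E)%E.
Proof.
move=> Wuniq WP.
have -> : [set v | forall k, pos (s k) (coord U (latt R v) 0 k)] = reduced 0.
  by apply/seteqP; split=> v vP k; [split | exact: (vP k).1].
have r1 k : 0 < 1 - r k by rewrite subr_gt0; case/andP: (r01 k).
have peel j : (j <= d)%N -> (\esum_(v in reduced 0) (f v)%:E =
    \esum_(v in reduced j) (f v * \prod_(k < d | (k < j)%N) (1 - r k)^-1)%:E)%E.
  elim: j => [_|j ih jd]; first by apply: eq_esum => v _; rewrite big1 ?mulr1.
  rewrite ih ?(ltnW jd)//; rewrite (esum_reduced_step (Ordinal jd)); last first.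
    by rewrite prodr_ge0// => k _; rewrite invr_ge0 ltW.
  apply: eq_esum => v _; congr (_ * _)%:E.
  rewrite [RHS](bigD1 (Ordinal jd))//= mulrC; congr (_ * _).
  apply: eq_bigl => k; rewrite ltnS -val_eqE/=.
  by case: ltngtP.
rewrite (peel d)//.
have -> : reduced d = [set` W].
  apply/seteqP; split=> v /=.
    by move=> vr; apply/WP => k; rewrite /unit_part (vr k).1 (vr k).2.
  by move=> /WP vW k; case/andP: (vW k).
rewrite esum_fset => [||v _]; [|exact: finite_seq|].
  rewrite -fsbig_seq// sumEFin -mulr_suml -prodfV; congr (_ * _)%:E.
  by apply: eq_bigl => k; rewrite ltn_ord.
by rewrite lee_fin mulr_ge0// prodr_ge0// => k _; rewrite invr_ge0 ltW.
Qed.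

End HalfOpenSum.

(** * The closed form attached to a triangulation *)

Lemma latt_row (R : realType) (d : nat) (U : 'M[int]_d) k :
  latt R (row k U) = row k (real_mx R U).
Proof. by apply/rowP => j; rewrite !mxE. Qed.

Lemma latt_row_neq0 (R : realType) (d : nat) (U : 'M[int]_d) k :
  \det U != 0 -> latt R (row k U) != 0.
Proof.
move=> U0; apply/eqP => uk.
have := coord_mul (delta_mx 0 k : 'rV[R]_d) U0; rewrite -rowE -latt_row uk.
rewrite /coord mul0mx => /rowP/(_ k); rewrite !mxE !eqxx => /eqP.
by rewrite eq_sym oner_eq0.
Qed.

(** An interior functional of a full-dimensional cone exposes the common
    minimiser [p]: another minimiser would take the same value as [p] on each of
    the generators, which form a basis. *)
Lemma cone_minimizer_vertex (R : realType) (d : nat) (P : set 'cV[R]_d) U p :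
  \det U != 0 -> (forall v, cone U v -> minimizes P v p) -> is_vertex p P.
Proof.
move=> U0 pmin; pose u k := latt R (row k U).
have umin k : minimizes P (u k) p by apply: pmin; exact: cone_row.
have Pp : P p.
  by apply: (pmin 0 _).1; exists (fun=> 0) => //; rewrite big1// => k _; rewrite scale0r.
pose l := \sum_k u k.
have lE x : pairing l x = \sum_k pairing (u k) x by rewrite /pairing mulmx_suml summxE.
split; first by exists p.
exists (pairing l); apply/seteqP; split=> [x -> /=|x [Px xmin] /=].
  split=> // y Py; rewrite /= !lE; apply: ler_sum => k _; exact: (umin k).2.
have : \sum_k (pairing (u k) x - pairing (u k) p) == 0.
  rewrite sumrB -!lE subr_eq0 eq_le; apply/andP; split; first exact: xmin.
  by rewrite !lE; apply: ler_sum => k _; exact: (umin k).2.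
rewrite psumr_eq0 => [/allP ux|k _]; last by rewrite subr_ge0; exact: (umin k).2.
have ux0 : real_mx R U *m (x - p) = 0.
  apply/colP => k; have := ux k (mem_index_enum k); rewrite /= subr_eq0 => /eqP xp.
  have : (row k (real_mx R U) *m (x - p)) 0 0 = 0.
    by rewrite -latt_row -/(pairing _ _) pairingD (raddfN (pairing _)) /= -/(u k) xp subrr.
  by rewrite -row_mul [LHS]mxE => ->; rewrite mxE.
by apply/eqP; rewrite -subr_eq0 -[x - p](mulKmx (real_mx_unit R U0)) ux0 mulmx0.
Qed.

(** The expansion, as an exponential sum, of the product of the factors
    [1 - y^(u (p - z))] for [u] in [us]. *)
Fixpoint prod_1sub (R : realType) (d : nat) (p : 'cV[R]_d) (us : seq 'rV[int]_d) :
    expsum R d :=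
  if us is u :: us' then
    prod_1sub p us' ++ [seq (- t.1.1, t.1.2 + u, p) | t <- prod_1sub p us']
  else [:: (1, 0, p)].

Lemma prod_1sub_at (R : realType) (d : nat) (p : 'cV[R]_d) us t :
  t \in prod_1sub p us -> t.2 = p.
Proof.
elim: us t => [|u us ih] t; first by rewrite inE => /eqP ->.
by rewrite mem_cat => /orP[/ih //|/mapP[q _ ->]].
Qed.

Lemma lattD (R : realType) (d : nat) (v w : 'rV[int]_d) :
  latt R (v + w) = latt R v + latt R w.
Proof. exact: map_mxD. Qed.

Lemma pairingDl (R : realType) (d : nat) (v w : 'rV[R]_d) x :
  pairing (v + w) x = pairing v x + pairing w x.
Proof. by rewrite /pairing mulmxDl mxE. Qed.

Lemma pairingZl (R : realType) (d : nat) a (v : 'rV[R]_d) x :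
  pairing (a *: v) x = a * pairing v x.
Proof. by rewrite /pairing -scalemxAl mxE. Qed.

Lemma eval_prod_1sub (R : realType) (d : nat) (p : 'cV[R]_d) us y z : 0 < y ->
  eval_expsum (prod_1sub p us) y z
  = \prod_(u <- us) (1 - y `^ pairing (latt R u) (p - z)).
Proof.
move=> y0; elim: us => [|u us ih].
  rewrite big_nil /eval_expsum big_seq1 /= /latt map_mx0 /pairing mul0mx mxE.
  by rewrite powRr0 mul1r.
rewrite big_cons -ih /eval_expsum /= big_cat big_map /= mulrBl mul1r; congr (_ + _).
rewrite mulr_sumr -sumrN !big_seq; apply: eq_bigr => t /prod_1sub_at ->.
rewrite rmorphN /= lattD pairingDl powRD; last by rewrite (gt_eqF y0) implybT.
by ring.
Qed.

(** One quotient for each cone: the sum over the points [W i] of its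
    parallelepiped, divided by the product coming from the geometric series of
    its generators. *)
Definition fan_closed_form (R : realType) (d : nat) N (T : 'I_N -> 'M[int]_d)
    (p : 'I_N -> 'cV[R]_d) (W : 'I_N -> seq 'rV[int]_d) : quotsum R d :=
  [seq ([seq (1, w, p i) | w <- W i],
        prod_1sub (p i) [seq row k (T i) | k <- enum 'I_d]) | i <- enum 'I_N].

Section FanClosedForm.
Variables (R : realType) (d N : nat) (T : 'I_N -> 'M[int]_d).
Variables (p : 'I_N -> 'cV[R]_d) (W : 'I_N -> seq 'rV[int]_d).

Lemma eval_fan_closed_form y z : 0 < y ->
  eval_quotsum (fan_closed_form T p W) y z =
  \sum_i (\sum_(w <- W i) y `^ pairing (latt R w) (p i - z))
         / \prod_k (1 - y `^ pairing (latt R (row k (T i))) (p i - z)).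
Proof.
move=> y0; rewrite /eval_quotsum /fan_closed_form big_map big_enum.
apply: eq_bigr => i _ /=; rewrite eval_prod_1sub// big_map big_enum.
by congr (_ / _); rewrite /eval_expsum big_map; apply: eq_bigr => w _; rewrite mul1r.
Qed.

Lemma powR_neq1 (y a : R) : 0 < y -> y != 1 -> a != 0 -> 1 - y `^ a != 0.
Proof.
move=> y0 y1 a0; rewrite subr_eq0 eq_sym; apply: contra y1 => /eqP ya1.
have : a * ln y = 0 by rewrite -ln_powR ya1 ln1.
by move=> /eqP; rewrite mulf_eq0 (negbTE a0) /= ln_eq0// => /eqP ->.
Qed.

Lemma fan_closed_form_defined y z : 0 < y -> y != 1 ->
  (forall i k, pairing (latt R (row k (T i))) (p i - z) != 0) ->
  defined_at (fan_closed_form T p W) y z.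
Proof.
move=> y0 y1 pz; split=> // _ /mapP[i _ ->] /=.
rewrite eval_prod_1sub// big_map big_enum; apply/prodf_neq0 => k _.
exact: powR_neq1.
Qed.

Variables (P : set 'cV[R]_d) (x : 'rV[R]_d).
Hypothesis T0 : forall i, \det (T i) != 0.
Hypothesis pmin : forall i v, cone (T i) v -> minimizes P v (p i).
Hypothesis xT : forall v : 'rV[R]_d,
  exists i, forall j, half_open x (T j) v <-> j = i.
Hypothesis Wuniq : forall i, uniq (W i).
Hypothesis WP : forall i v, v \in W i <->
  forall k, unit_part (0 < coord (T i) x 0 k) (coord (T i) (latt R v) 0 k).

Lemma half_open_cone i v : half_open x (T i) v -> cone (T i) v.
Proof.
move=> v0; apply/coneP => // k; have := v0 k.
by rewrite /pos; case: ifP => // _ /ltW.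
Qed.

(** The hypothesis that [z] is interior makes every ratio of the geometric series
    less than 1. *)
Lemma half_open_series y z i : 1 < y -> P° z ->
  (\esum_(v in [set v | half_open x (T i) (latt R v)])
      (y `^ (- supp_fun (translate P z) (latt R v)))%:E =
   ((\sum_(w <- W i) y `^ pairing (latt R w) (p i - z))
         / \prod_k (1 - y `^ pairing (latt R (row k (T i))) (p i - z)))%:E)%E.
Proof.
move=> y1 Pz; have y0 : 0 < y by exact: lt_trans y1.
have yn0 (r s : R) : (r + s == 0) ==> (y != 0) by rewrite (gt_eqF y0) implybT.
have -> : (\esum_(v in [set v | half_open x (T i) (latt R v)])
      (y `^ (- supp_fun (translate P z) (latt R v)))%:E =
    \esum_(v in [set v | half_open x (T i) (latt R v)])
      (y `^ pairing (latt R v) (p i - z))%:E)%E.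
  apply: eq_esum => v vi; rewrite (supp_fun_minimizes _ (pmin (half_open_cone vi))).
  by rewrite opprK.
apply: (esum_half_open (T0 i)) => // [v|k|v k n _]; first exact: powR_ge0.
  rewrite powR_ge0 /powR gt_eqF// expR_lt1 pmulr_llt0 ?ln_gt0//=.
  apply: (interior_pairing_lt0 _ Pz (pmin (cone_row _ _ _))).
  exact: latt_row_neq0.
rewrite lattD pairingDl powRD//; congr (_ * _).
have -> : latt R (n%:Z *: row k (T i)) = n%:R *: latt R (row k (T i)).
  by rewrite /latt map_mxZ.
by rewrite pairingZl mulrC powRrM powR_mulrn// powR_ge0.
Qed.

Lemma fan_closed_form_series y z : 1 < y -> P° z ->
  dual_series P y z = (eval_quotsum (fan_closed_form T p W) y z)%:E.
Proof.
move=> y1 Pz; rewrite eval_fan_closed_form; last exact: lt_trans y1.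
pose H i := [set v | half_open x (T i) (latt R v)].
pose F v := (y `^ (- supp_fun (translate P z) (latt R v)))%:E.
rewrite /dual_series -sumEFin.
under [RHS]eq_bigr do rewrite -half_open_series//.
under [RHS]eq_bigr do rewrite esum_mkcond.
rewrite -esum_sum; last by move=> v i _ _; case: ifP => // _; rewrite lee_fin powR_ge0.
apply: eq_esum => v _; have [i iP] := xT (latt R v).
rewrite (bigD1 i)//= big1 => [|j ji].
  by rewrite adde0 ifT//; apply/mem_set/iP.
by rewrite ifF//; apply/negP => /set_mem/iP/eqP; rewrite (negbTE ji).
Qed.

Lemma fan_closed_formP : is_closed_form P (fan_closed_form T p W).
Proof.
have pvert i : is_vertex (p i) P by exact: cone_minimizer_vertex (T0 i) (@pmin i).
split.
  move=> _ /mapP[i _ ->]; split=> t /=; first by move=> /mapP[w _ ->]; exact: pvert.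
  by move=> /prod_1sub_at ->; exact: pvert.
move=> y z y1 Pz; split; last exact: fan_closed_form_series.
apply: fan_closed_form_defined; [exact: lt_trans y1 | by rewrite gt_eqF |].
move=> i k; rewrite lt_eqF//.
by apply: (interior_pairing_lt0 _ Pz (pmin (cone_row _ _ _))); exact: latt_row_neq0.
Qed.

End FanClosedForm.

(** * The limit *)

(** The inverse of the difference quotient at 0 of [e |-> - expR (e * b)]. *)
Lemma cvg_geometric_pole (R : realType) (b : R) : b != 0 ->
  e / (1 - expR (e * b)) @[e --> 0^'] --> - b^-1.
Proof.
move=> b0.
have D : is_derive (0 : R) 1 (expR \o (fun e : R => e * b)) b.
  have lin : is_derive (0 : R) 1 (fun e : R => e * b) b.
    by apply: is_derive_eq; rewrite scaler0 add0r; exact: mulr1.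
  have := @is_derive1_comp _ expR (fun e => e * b) 0 _ _ (is_derive_expR (0 * b)) lin.
  by rewrite mul0r expR0 mul1r.
have : (1 - expR (e * b)) / e @[e --> 0^'] --> - b.
  have [dv dE] := D; rewrite -dE; apply: cvg_trans (cvgN dv).
  apply: near_eq_cvg; apply: nearW => e.
  rewrite dE fctE /= addr0 mul0r expR0 (_ : e%:A = e); last exact: mulr1.
  by rewrite -scalerN opprB [RHS]mulrC.
move=> /(cvgV _); rewrite oppr_eq0 => /(_ b0); rewrite invrN.
apply: cvg_trans; apply: near_eq_cvg; near=> e.
by rewrite /= invfM invrK mulrC.
Unshelve. all: by end_near. Qed.

Lemma cvg_bigD (R : realType) (I : Type) (r : seq I) (F : set_system R)
    {FF : Filter F} (f : I -> R -> R) (l : I -> R) :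
  (forall i, f i e @[e --> F] --> l i) ->
  \sum_(i <- r) f i e @[e --> F] --> \sum_(i <- r) l i.
Proof.
move=> fl; elim: r => [|i r ih].
  by rewrite big_nil; under eq_cvg do rewrite big_nil; exact: cvg_cst.
by rewrite big_cons; under eq_cvg do rewrite big_cons; exact: cvgD.
Qed.

Lemma cvg_bigM (R : realType) (I : Type) (r : seq I) (F : set_system R)
    {FF : Filter F} (f : I -> R -> R) (l : I -> R) :
  (forall i, f i e @[e --> F] --> l i) ->
  \prod_(i <- r) f i e @[e --> F] --> \prod_(i <- r) l i.
Proof.
move=> fl; elim: r => [|i r ih].
  by rewrite big_nil; under eq_cvg do rewrite big_nil; exact: cvg_cst.
by rewrite big_cons; under eq_cvg do rewrite big_cons; exact: cvgM.
Qed.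

Lemma dual_lattice_functionE (R : realType) (d : nat) (P : set 'cV[R]_d) Q y z :
  P° !=set0 -> is_closed_form P Q -> defined_at Q y z ->
  dual_lattice_function P y z = eval_quotsum Q y z.
Proof.
move=> P0 QP Qyz; rewrite /dual_lattice_function.
case: xgetP => [_ -> [Q' [Q'P Q'yz ->]]|/(_ (eval_quotsum Q y z))]; last first.
  by case; exists Q.
exact: closed_form_unique P0 Q'P QP Q'yz Qyz.
Qed.

Theorem theorem3p21 (R : realType) (d : nat) (P : set 'cV[R]_d)
  (ratP : rational_polytope P) (fullP : full_dimensional P)
  (N : nat) (T : 'I_N -> 'M[int]_d) (triT : is_triangulation P T)
  (z : 'cV[R]_d)
  (hz : forall (i : 'I_N) (k : 'I_d),
      supp_fun (translate P z) (latt R (row k (T i))) != 0) :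
  (fun e : R => e ^+ d / (d`!)%:R * dual_lattice_function P (expR e) z)
    @ 0^' --> dual_volume P T z / (d`!)%:R.
Proof.
have [Ppol _] := ratP; have [Tprim Tinj Tface Tfan Tcover] := triT.
have T0 i : \det (T i) != 0 by exact: (Tprim i).1.
have Pint := full_polytope_interior Ppol fullP.
have P0 : P !=set0 by case: Pint => c /interior_subset; exists c.
have /choice[p pmin] : forall i, exists p, forall v, cone (T i) v -> minimizes P v p.
  move=> i; have [C CF TC] := Tfan i.
  have [p Cp] := normal_cone_minimizes Ppol CF.
  by exists p => v /TC; exact: Cp.
have [x x0] : exists x : 'rV[R]_d, forall i k, coord (T i) x 0 k != 0.
  have [|x xP] := @generic_direction R d ('I_N * 'I_d)%type
      (fun ik => col ik.2 (invmx (real_mx R (T ik.1)))).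
    move=> [i k] /=; apply/eqP => /colP ck.
    have /matrixP/(_ k k) := mulmxV (real_mx_unit R (T0 i)).
    rewrite [RHS]mxE eqxx mxE big1 => [/eqP|j _]; first by rewrite eq_sym oner_eq0.
    by have := ck j; rewrite [LHS]mxE [RHS]mxE => ->; rewrite mulr0.
  by exists x => i k; have := xP (i, k); rewrite /= colE mulmxA -colE mxE.
have part := half_open_partition T0 x0 Tinj Tface
  (etrans Tcover (normal_fan_complete Ppol P0)).
have /choice[W WP] := fun i =>
  parallelepiped_points R (fun k => 0 < coord (T i) x 0 k) (T0 i).
have Qclosed : is_closed_form P (fan_closed_form T p W).
  apply: (fan_closed_formP T0 pmin part); first by move=> i; case: (WP i).
  by move=> i; case: (WP i).
pose a i (w : 'rV[int]_d) := pairing (latt R w) (p i - z).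
have suppE i k : supp_fun (translate P z) (latt R (row k (T i))) = - a i (row k (T i)).
  by apply: supp_fun_minimizes; apply: pmin; exact: cone_row.
have a0 i k : a i (row k (T i)) != 0 by rewrite -oppr_eq0 -suppE; exact: hz.
(* In the limit each numerator becomes the number of points of a
   parallelepiped, and each denominator, divided by [e ^+ d], the product of the
   values of the support function. *)
rewrite (_ : dual_volume P T z / _ = (\sum_i (\sum_(w <- W i) 1) *
    \prod_k - (a i (row k (T i)))^-1) / (d`!)%:R); last first.
  congr (_ / _); apply: eq_bigr => i _; congr (_ * _).
    have [Ws _ _] := WP i.
    by rewrite big_const_seq count_predT Ws iter_addr_0 -pmulrn.
  by rewrite -prodfV; apply: eq_bigr => k _; rewrite suppE invrN.
(* The power [e ^+ d] is distributed over the [d] factors of each denominator. *)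
apply: (@cvg_trans _ ((fun e => (\sum_i (\sum_(w <- W i) expR (e * a i w)) *
    \prod_k (e / (1 - expR (e * a i (row k (T i)))))) / (d`!)%:R) @ 0^')).
  apply: near_eq_cvg; near=> e.
  have e0 : e != 0 by near: e; exact: nbhs_dnbhs_neq.
  rewrite (dual_lattice_functionE Pint Qclosed); last first.
    by apply: fan_closed_form_defined => //; rewrite ?expR_gt0// -expR0 (inj_eq (@expR_inj R)).
  rewrite eval_fan_closed_form ?expR_gt0// mulrAC mulr_sumr.
  congr (_ / _); apply: eq_bigr => i _.
  rewrite big_split/= prodr_const card_ord prodfV mulrCA; congr (_ * (_ / _)).
    by apply: eq_bigr => w _; rewrite expRM.
  by apply: eq_bigr => k _; rewrite expRM.
apply: cvgM; last exact: cvg_cst.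
apply: cvg_bigD => i; apply: cvgM.
  apply: cvg_bigD => w; rewrite -expR0 -[X in expR X](mul0r (a i w)).
  apply: (@cvg_trans _ (expR (e * a i w) @[e --> nbhs (0 : R)])).
    by apply: cvg_app; exact: cvg_within.
  apply: (@continuous_comp _ _ _ (fun e : R => e * a i w) expR).
    by apply: cvgM; [exact: cvg_id | exact: cvg_cst].
  exact: continuous_expR.
by apply: cvg_bigM => k; exact: cvg_geometric_pole.
Unshelve. all: by end_near. Qed.
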